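(* Let $\varphi$ be a quasi-concave function for which there is a constant $C>0$ with $\varphi(t)\ge C\,t\log(1+1/t)$ for all $t>0$, and let $$\widetilde{\varphi}(t)=\inf_{r>0}\frac{t\,\varphi(r)}{r\log(1+t/r)},\qquad t>0.$$ The following statements are equivalent: (i) There exists a quasi-concave function $\phi$ such that $\Lambda_\varphi=R(M_\phi)$. (ii) $\Lambda_\varphi=R(M_{\widetilde{\varphi}})$. (iii) There exists $K>0$ such that for all $t>0$ there is $u_t>0$ satisfying $$\inf_{r>0}\frac{\varphi(r)}{r\log(1+u_t/r)}\le\frac{\varphi(t)}{t\log(1+u_t/t)}\le K\inf_{r>0}\frac{\varphi(r)}{r\log(1+u_t/r)}.$$ (iv) There exist sequences of positive real numbers $(a_k)$, $(b_k)$ such that $$\varphi(t)\approx t\,\sup_k b_k\log\Big(1+\frac{a_k}{t}\Big).$$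
   Context: All function spaces consist of measurable functions on $(0,\infty)$ with Lebesgue measure. Equality of spaces means equality as sets with equivalent norms. ''Increasing'' and ''decreasing'' are in the weak sense. $f^*$ is the decreasing rearrangement of $f$ and $f^{**}(t)=\frac1t\int_0^t f^*(s)\,ds$. $A\approx B$ means $c^{-1}B(t)\le A(t)\le cB(t)$ for some constant $c>0$ independent of $t>0$. A function $\varphi:(0,\infty)\to(0,\infty)$ is quasi-concave if it is increasing and $\varphi(t)/t$ is decreasing; we put $\varphi(0)=0$. The Lorentz space $\Lambda_\varphi$ consists of all $f$ with $\|f\|_{\Lambda_\varphi}=\int_0^\infty f^*(t)\,d\varphi(t)<\infty$, where the Stieltjes integral includes the mass $\varphi(0+)$ at the origin. The Marcinkiewicz space $M_\varphi$ consists of all $f$ with $\|f\|_{M_\varphi}=\sup_{t>0}f^{**}(t)\varphi(t)<\infty$. (Under the stated hypothesis on $\varphi$, $\widetilde\varphi$ is quasi-concave.) For a rearrangement invariant space $X$ on $(0,\infty)$, $W_X(t)=\big\|\frac{1}{1+\cdot/t}\big\|_X$ and $R(X)=\Lambda_{W_X}$; if $1/(1+s)\notin X$ then $R(X)=\{0\}$. *)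

(* Defs.v *)
From HB Require Import structures.
From mathcomp Require Import all_boot all_order all_algebra.
From mathcomp Require Import all_classical all_reals all_analysis.
Set Implicit Arguments.
Unset Strict Implicit.
Unset Printing Implicit Defensive.
Import Order.TTheory GRing.Theory Num.Theory.
Import numFieldNormedType.Exports.

Local Open Scope classical_set_scope.
Local Open Scope ring_scope.

(* Functions on (0, +oo) are represented by total functions on R of which only
   the values on (0, +oo) are ever used. *)
Section defs.
Context {R : realType}.
Implicit Types (phi : R -> R) (f : R -> R).

Local Notation mu := (@lebesgue_measure R).

Definition quasi_concave phi : Prop :=
  [/\ forall t, 0 < t -> 0 < phi t,
      forall s t, 0 < s -> s <= t -> phi s <= phi t &
      forall s t, 0 < s -> s <= t -> phi t / t <= phi s / s].

Definition rearr f (t : R) : \bar R :=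
  ereal_inf [set s%:E | s in
    [set s : R | 0 <= s /\
       (mu [set x : R | (0 < x)%R /\ (s < `|f x|)%R] <= t%:E)%E]].

Definition rearr_avg f (t : R) : \bar R :=
  ((t^-1)%:E * \int[mu]_(s in `]0%R, t]) rearr f s)%E.

(* The distribution function of the Stieltjes measure d phi on [0, +oo). For a
   quasi-concave phi it is 0 on (-oo, 0), phi(0+) at 0 and phi on (0, +oo)
   (lemmas [stieltjes_df_gt0] and [stieltjes_df0] below), so that the origin has
   mass phi(0+). The infimum and the absolute value make it nondecreasing and
   right-continuous for every phi. *)
Definition stieltjes_df phi (t : R) : R :=
  if 0 <= t then inf [set `|phi s| | s in `]t, +oo[] else 0.

Lemma stieltjes_df_has_inf phi t : has_inf [set `|phi s| | s in `]t, +oo[].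
Proof.
split; last by exists 0 => _ [s _ <-].
exists `|phi (t + 1)|; exists (t + 1) => //=.
by rewrite in_itv/= andbT ltrDl.
Qed.

Lemma stieltjes_df_nd phi : nondecreasing (stieltjes_df phi).
Proof.
move=> s t st; rewrite /stieltjes_df; case: ifPn => [s0|_].
  rewrite (le_trans s0 st); apply: lb_le_inf.
    by case: (stieltjes_df_has_inf phi t).
  move=> _ [x /= + <-]; rewrite in_itv/= andbT => tx.
  apply: ge_inf; first by case: (stieltjes_df_has_inf phi s).
  by exists x => //=; rewrite in_itv/= andbT (le_lt_trans st).
case: ifPn => // _; apply: lb_le_inf.
  by case: (stieltjes_df_has_inf phi t).
by move=> _ [x _ <-].
Qed.

Lemma stieltjes_df_rc phi : right_continuous (stieltjes_df phi).
Proof.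
move=> t; apply/cvgrPdist_le => e e0.
have [t0|t0] := leP 0 t; last first.
  near=> x; rewrite /stieltjes_df (lt_geF t0).
  have x0 : x < 0 by near: x; exact: nbhs_right_lt.
  by rewrite (lt_geF x0) subrr normr0 ltW.
have [_ [z /= + <-]] := inf_adherent e0 (stieltjes_df_has_inf phi t).
rewrite in_itv/= andbT => tz hz.
near=> x.
have tx : t <= x by near: x; exact: nbhs_right_ge.
have xz : x < z by near: x; exact: nbhs_right_lt.
rewrite distrC ger0_norm; last by rewrite subr_ge0 stieltjes_df_nd.
rewrite lerBlDl; apply/ltW.
rewrite {2}/stieltjes_df t0; apply: le_lt_trans hz.
rewrite /stieltjes_df (le_trans t0 tx).
apply: ge_inf; first by case: (stieltjes_df_has_inf phi x).
by exists z => //=; rewrite in_itv/= andbT.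
Unshelve. all: by end_near. Qed.

HB.instance Definition _ phi :=
  isCumulative.Build R _ R (stieltjes_df phi)
    (@stieltjes_df_nd phi) (@stieltjes_df_rc phi).

Lemma stieltjes_df_gt0 phi t :
  quasi_concave phi -> 0 < t -> stieltjes_df phi t = phi t.
Proof.
move=> [p0 nd ni] t0; rewrite /stieltjes_df (ltW t0).
have [ne lb] := stieltjes_df_has_inf phi t.
apply/eqP; rewrite eq_le; apply/andP; split; last first.
  apply: lb_le_inf => // _ [s /= + <-]; rewrite in_itv/= andbT => ts.
  by rewrite gtr0_norm ?p0 ?(lt_trans t0)// nd// ltW.
apply/ler_addgt0Pr => e e0.
have et0 : 0 < e / (phi t / t) by rewrite !divr_gt0 ?p0.
have s0 : 0 < t + e / (phi t / t) by rewrite addr_gt0.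
apply: (@le_trans _ _ (phi (t + e / (phi t / t)))).
  apply: ge_inf => //; exists (t + e / (phi t / t)).
    by rewrite /= in_itv/= andbT ltrDl.
  by rewrite gtr0_norm// p0.
have := ni t (t + e / (phi t / t)) t0; rewrite lerDl (ltW et0) => /(_ isT).
rewrite ler_pdivrMr// => /le_trans; apply.
rewrite mulrDr divfK ?gt_eqF// [X in _ + X]mulrC divfK//.
by rewrite gt_eqF// divr_gt0 ?p0.
Qed.

Lemma stieltjes_df0 phi :
  quasi_concave phi -> phi x @[x --> 0^'+] --> stieltjes_df phi 0.
Proof.
move=> qc; apply: cvg_trans (@stieltjes_df_rc phi 0).
apply: near_eq_cvg; near=> x; rewrite stieltjes_df_gt0//.
Unshelve. all: by end_near. Qed.

(* A function space is given by its norm, with value +oo outside the space. *)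
Definition fnorm := (R -> R) -> \bar R.
Implicit Types X Y : fnorm.

(* [measurable_fun] is Borel measurability here; up to a.e. equality this gives
   the same function spaces as Lebesgue measurability. *)
Definition in_space X f : Prop :=
  measurable_fun (`]0, +oo[ : set R) f /\ (X f < +oo)%E.

Definition same_space X Y : Prop :=
  (forall f, in_space X f <-> in_space Y f) /\
  exists2 c : R, 0 < c & forall f, in_space X f ->
    ((c^-1)%:E * Y f <= X f)%E /\ (X f <= c%:E * Y f)%E.

Definition lorentz phi : fnorm := fun f =>
  (\int[lebesgue_stieltjes_measure (stieltjes_df phi)]_(t in `[0%R, +oo[)
     rearr f t)%E.

Definition marcinkiewicz phi : fnorm := fun f =>
  ereal_sup [set (rearr_avg f t * (phi t)%:E)%E | t in (`]0, +oo[ : set R)].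

Definition zero_space : fnorm := fun f =>
  if `[< {ae mu, forall x, 0 < x -> f x = 0} >] then 0%E else +oo%E.

Definition Wfun X (t : R) : \bar R := X (fun s => (1 + s / t)^-1).

Definition Rspace X : fnorm :=
  if `[< in_space X (fun s => (1 + s)^-1) >]
  then lorentz (fun t => fine (Wfun X t)) else zero_space.

Definition qc_tilde phi (t : R) : R :=
  inf [set t * phi r / (r * ln (1 + t / r)) | r in (`]0, +oo[ : set R)].

Definition approx_eq (A B : R -> \bar R) : Prop :=
  exists2 c : R, 0 < c & forall t, 0 < t ->
    ((c^-1)%:E * B t <= A t)%E /\ (A t <= c%:E * B t)%E.

End defs.

(* Main.v *)
(* The norm of 1/(1 + s/t) in the Marcinkiewicz space M_psi is computed
   explicitly: W(t) = sup_r (t/r) ln(1 + r/t) psi(r). Two Lorentz spaces agree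
   as soon as their fundamental functions are equivalent (layer-cake formula:
   the level sets of f^* are initial segments, whose Stieltjes masses are the
   values of the fundamental functions), and indicators of ]0, t[ give the
   converse, so Lambda_phi = R(M_psi) means phi ~ W. An upper bound W <= c phi
   says exactly psi <= c phi~, so phi~ is the largest possible psi, and
   phi ~ sup_u phi~(u) (t/u) ln(1 + u/t) is a near-attainment statement (iii);
   restricting t to the positive rationals gives the sequences in (iv). *)

Require Import Defs.
From mathcomp Require Import all_boot all_order all_algebra.
From mathcomp Require Import all_classical all_reals all_analysis.
From mathcomp Require Import measurable_realfun measurable_fun_approximation real_interval.
From mathcomp Require Import ring lra.
Set Implicit Arguments.
Unset Strict Implicit.
Unset Printing Implicit Defensive.
Import Order.TTheory GRing.Theory Num.Theory.
Import numFieldNormedType.Exports.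

Local Open Scope classical_set_scope.
Local Open Scope ring_scope.

(** * Layer-cake formula and comparison of integrals *)

(** Tonelli on the region [A] of pairs with [0 <= s < h x], where [h] extends [g] by zero: its
    section at [x] has Lebesgue measure [h x], its section at [s >= 0] is the layer of [g] above
    [s]. *)
Lemma ge0_integral_layer_cake d (T : measurableType d) (R : realType)
    (m : {sigma_finite_measure set T -> \bar R}) (D : set T) (g : T -> \bar R) :
  measurable D -> measurable_fun D g -> (forall x, D x -> 0 <= g x)%E ->
  (\int[m]_(x in D) g x =
   \int[@lebesgue_measure R]_(s in `[0%R, +oo[) m (D `&` [set x | s%:E < g x]))%E.
Proof.
move=> mD mg g0.
pose h := (g \_ D)%E.
have mh : measurable_fun setT h by exact/(measurable_restrictT _ mD).
have h0 x : (0 <= h x)%E by rewrite /h patchE; case: ifPn => //; rewrite inE => /g0.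
pose A : set (T * measurableTypeR R) := [set p | 0 <= p.2 /\ (p.2%:E < h p.1)%E].
have mA : measurable A.
  have -> : A = (setT `&` [set p | (0%:E <= p.2%:E)%E]) `&` (setT `&` [set p : T * R | (p.2%:E < h p.1)%E]).
    apply/seteqP; split => p /=; rewrite lee_fin; first by move=> [].
    by move=> [[_ ?] [_ ?]].
  apply: measurableI.
    apply: measurable_lee => //; first exact/measurable_EFinP.
  apply: measurable_lte => //.
    exact/measurable_EFinP.
  exact: measurableT_comp.
rewrite integral_mkcond -/h.
transitivity (\int[m]_x \int[@lebesgue_measure R]_s (\1_A (x, s))%:E)%E.
  apply: eq_integral => x _.
  transitivity (\int[@lebesgue_measure R]_s
      (\1_[set s : R | 0 <= s /\ (s%:E < h x)%E] s)%:E)%E; last first.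
    by apply: eq_integral => s _; rewrite !indicE.
  (* The second branch is meant for [+oo]; the value [-oo] is excluded by [h0]. *)
  have -> : [set s : R | 0 <= s /\ (s%:E < h x)%E] =
            if h x is r%:E then `[0, r[%classic else `[0, +oo[%classic.
    apply/seteqP; split => s /=; case: (h x) (h0 x) => [r| |] //= _;
      rewrite ?in_itv /= ?lte_fin ?andbT; try by move=> [-> ->].
    - by move=> [].
    - by move=> /andP[-> ->].
    - by move=> ->; rewrite ltry.
  have mitv (b : itv_bound R) : (\int[@lebesgue_measure R]_s
      (\1_[set` Interval (BLeft 0%R) b] s)%:E = lebesgue_measure [set` Interval (BLeft 0%R) b])%E.
    by rewrite integral_indic// setIT.
  case: (h x) (h0 x) => [r r0|_|//]; rewrite mitv lebesgue_measure_itv/=; last by rewrite ltry.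
  rewrite lee_fin in r0; rewrite lte_fin; case: ltP => [|r0']; first by rewrite sube0.
  by apply/eqP; rewrite eqe eq_le r0' r0.
apply: (etrans (indic_fubini_tonelli m (@lebesgue_measure R) mA)).
rewrite indic_fubini_tonelli_GE//.
rewrite [RHS]integral_mkcond; apply: eq_integral => s _ /=.
rewrite patchE; case: ifPn => [|].
  rewrite inE/= in_itv/= andbT => s0; congr (m _).
  apply/seteqP; split => x; rewrite /ysection /= ?inE /A/=.
    move=> [_]; rewrite /h patchE; case: ifPn; first by rewrite inE.
    by rewrite lte_fin ltNge s0.
  by move=> [Dx sg]; split => //; rewrite /h patchE mem_set.
rewrite notin_setE/= in_itv/= andbT => /negP s0.
rewrite -[RHS](measure0 m); congr (m _).
apply/seteqP; split => x //; rewrite /ysection /= ?inE /A/= => -[s0' _].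
by rewrite s0' in s0.
Qed.

(** Superlevel sets of a monotone function are intervals. *)
Lemma nonincreasing_emeasurable (R : realType) (D : set R) (f : R -> \bar R) :
  measurable D -> {homo f : x y / x <= y >-> (y <= x)%E} -> measurable_fun D f.
Proof.
move=> mD f_ni; apply: (measurable_funS measurableT) => //.
apply: (measurability _ (ErealGenOInfty.measurableE R)).
move=> /= _ [_ [a ->]] <-; apply: measurableI => //; apply: is_interval_measurable.
move=> x y /=; rewrite /= !in_itv/= !andbT => _ ay z /andP[_ zy].
by rewrite in_itv/= andbT (lt_le_trans ay)// f_ni.
Qed.

(** By the layer-cake formula the measures only have to be compared on the layers of [g]. This
    matters because a bound between fundamental functions does not bound the Stieltjes measures of
    arbitrary sets. *)
Lemma ge0_le_integral_layers d (T : measurableType d) (R : realType)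
    (m1 m2 : {sigma_finite_measure set T -> \bar R}) (D : set T)
    (g : T -> \bar R) (c : R) :
  measurable D -> measurable_fun D g -> (forall x, D x -> 0 <= g x)%E -> 0 <= c ->
  (forall s, 0 <= s -> (m1 (D `&` [set x | s%:E < g x]) <=
                        c%:E * m2 (D `&` [set x | s%:E < g x]))%E) ->
  (\int[m1]_(x in D) g x <= c%:E * \int[m2]_(x in D) g x)%E.
Proof.
move=> mD mg g0 c0 m12; rewrite (ge0_integral_layer_cake m1)// (ge0_integral_layer_cake m2)//.
have mlayer (s : R) : measurable (D `&` [set x | (s%:E < g x)%E]).
  exact: emeasurable_fun_o_infty.
have mm (m : {sigma_finite_measure set T -> \bar R}) (D' : set R) : measurable D' ->
    measurable_fun D' (fun s : R => m (D `&` [set x | (s%:E < g x)%E])).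
  move=> mD'; apply: nonincreasing_emeasurable => // s t st.
  apply: le_measure; rewrite ?inE//; apply: setIS => x /=.
  by apply: le_lt_trans; rewrite lee_fin.
rewrite -ge0_integralZl_EFin//; last exact: mm.
apply: ge0_le_integral => //.
- exact: (mm m1).
- by apply: measurable_funeM; exact: (mm m2).
- by move=> s /=; rewrite in_itv/= andbT => /m12.
Qed.

(** * Stieltjes measures of initial segments *)

Lemma le_stieltjes_df (R : realType) (phi1 phi2 : R -> R) (c t : R) : 0 < c ->
  (forall t, 0 < t -> `|phi1 t| <= c * `|phi2 t|) ->
  stieltjes_df phi1 t <= c * stieltjes_df phi2 t.
Proof.
move=> c0 le12; rewrite /stieltjes_df; case: ifPn => t0; last by rewrite mulr0.
rewrite -ler_pdivrMl//; apply: lb_le_inf; first by case: (stieltjes_df_has_inf phi2 t).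
move=> _ [s /= ts <-]; rewrite ler_pdivrMl//.
rewrite in_itv/= andbT in ts.
apply: (@le_trans _ _ `|phi1 s|); last by rewrite le12// (le_lt_trans t0).
apply: ge_inf; first by case: (stieltjes_df_has_inf phi1 t).
by exists s => //=; rewrite in_itv/= andbT.
Qed.

(** The segment is the decreasing intersection of the intervals []-1/(n+1), a]]. Since
    [stieltjes_df phi] vanishes on the negative axis, each of them has mass [stieltjes_df phi a],
    atom at the origin included. *)
Lemma stieltjes_measure_itv_cc (R : realType) (phi : R -> R) (a : R) : 0 <= a ->
  lebesgue_stieltjes_measure (stieltjes_df phi) `[0, a] = (stieltjes_df phi a)%:E.
Proof.
move=> a0; set mu := lebesgue_stieltjes_measure _.
pose F (n : nat) : set R := `]- n.+1%:R^-1, a]%classic.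
have n0 (n : nat) : - n.+1%:R^-1 < a :> R.
  by rewrite (lt_le_trans _ a0)// oppr_lt0 invr_gt0.
have muF n : mu (F n) = (stieltjes_df phi a)%:E.
  rewrite /mu /lebesgue_stieltjes_measure /measure_extension measurable_mu_extE/=; last first.
    by exists (- n.+1%:R^-1, a).
  rewrite wlength_itv/= lte_fin n0 /= /stieltjes_df [0 <= - _]leNgt oppr_lt0 invr_gt0.
  by rewrite ltr0n/= sube0.
have FE : `[0, a]%classic = \bigcap_n F n.
  apply/seteqP; split => [x /= xa n _|x Fx].
    move: xa; rewrite /F/= !in_itv/= => /andP[x0 ->].
    by rewrite andbT (lt_le_trans _ x0)// oppr_lt0 invr_gt0.
  have := Fx 0%N I; rewrite /F/= !in_itv/= => /andP[_ ->]; rewrite andbT leNgt.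
  apply/negP => x0; have [n] := ltr_add_invr x0.
  rewrite -ltrBrDr sub0r => xn.
  by have := Fx n I; rewrite /F/= in_itv/= ltNge (ltW xn).
have mF n : measurable (F n) by exact: measurable_itv.
have : mu \o F @ \oo --> mu (\bigcap_n F n).
  apply: nonincreasing_cvg_mu => //.
  - by rewrite [X in (X < _)%E](muF 0%N) ltry.
  - by rewrite -FE; exact: measurable_itv.
  - move=> n m nm; apply/subsetPset => x; rewrite /F/= !in_itv/= => /andP[xm ->].
    rewrite andbT (le_lt_trans _ xm)// lerN2 lef_pV2 ?posrE//.
    by rewrite ler_nat ltnS.
rewrite FE => muFcvg; apply/esym; apply: cvg_unique muFcvg => //=.
by apply: cvg_near_cst; apply: nearW => n; exact: muF.
Qed.

(** A nonempty initial segment is [[0, a]], [[0, a[] or [[0, +oo[]; the last two are increasing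
    unions of closed segments, so continuity from below applies. *)
Lemma le_measure_initial_segment (R : realType)
    (m1 m2 : {measure set (measurableTypeR R) -> \bar R}) (c : R) (A : set R) :
  (forall a, 0 <= a -> (m1 `[0%R, a]%classic <= c%:E * m2 `[0%R, a]%classic)%E) ->
  A `<=` `[0, +oo[ -> (forall x y, 0 <= x -> x <= y -> A y -> A x) ->
  (m1 A <= c%:E * m2 A)%E.
Proof.
move=> le_cc A0 Adown.
have [->|/set0P[x0 Ax0]] := eqVneq A set0; first by rewrite !measure0 mule0.
have le_cup (a : nat -> R) (B : set R) : {homo a : m n / (m <= n)%N >-> m <= n} ->
    B = \bigcup_n `[0, a n]%classic -> (m1 B <= c%:E * m2 B)%E.
  move=> a_nd ->.
  have cv (m : {measure set (measurableTypeR R) -> \bar R}) :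
      m (`[0, a n]%classic) @[n --> \oo] --> m (\bigcup_n `[0, a n]%classic).
    apply: nondecreasing_cvg_mu.
    - by move=> n; exact: measurable_itv.
    - by apply: bigcup_measurable => n _; exact: measurable_itv.
    - move=> m' n mn; apply/subsetPset => x /=; rewrite !in_itv/= => /andP[-> xa].
      by rewrite (le_trans xa)// a_nd.
  apply: (lee_cvg_to (cv m1) (cvgeZl _ (cv m2))) => //.
  (* The endpoints [a - 1/(n+1)] used below for [[0, a[] may be negative; the interval is then
     empty. *)
  apply: nearW => n; have [a0|a0] := leP 0 (a n); first exact: le_cc.
  by rewrite set_itv_ge ?measure0 ?mule0// bnd_simp -ltNge.
have A00 : A 0.
  have := A0 _ Ax0; rewrite /= in_itv/= andbT => x0_ge0.
  exact: (Adown _ _ (lexx 0) x0_ge0).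
have [u AE] : exists u, A = [set` Interval (BLeft 0) u].
  have : is_interval A.
    move=> x y /A0; rewrite /= in_itv/= andbT => x0' Ay z /andP[xz zy].
    by apply: (Adown _ _ _ zy Ay); rewrite (le_trans x0').
  move/is_intervalP; case: (Rhull A) => l u AE; exists u.
  have memA x : A x -> (l <= BLeft x)%O && (BRight x <= u)%O.
    by rewrite {1}AE /= itv_boundlr.
  rewrite {1}AE; apply/seteqP; split => x /=; rewrite itv_boundlr => /andP[lx xu].
    have : A x by rewrite AE /= itv_boundlr lx.
    by move=> /A0; rewrite itv_boundlr /= in_itv/= andbT bnd_simp xu => ->.
  by rewrite itv_boundlr xu (le_trans _ lx)//; have /andP[] := memA 0 A00.
have homo_n (x : R) : {homo (fun n : nat => x - n.+1%:R^-1) : m n / (m <= n)%N >-> m <= n}.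
  by move=> m n mn; rewrite lerD2l lerN2 lef_pV2 ?posrE// ler_nat ltnS.
move: u AE => [[] a|[]] AE.
- apply: (le_cup (fun n => a - n.+1%:R^-1)) => //.
  by rewrite AE itv_bnd_open_bigcup.
- rewrite AE; apply: le_cc.
  by move: A00; rewrite AE /= in_itv/= lexx.
- by have := A00; rewrite AE /= in_itv /= andbF.
- apply: (le_cup (fun n => 0 + n%:R)).
    by move=> m n mn; rewrite lerD2l ler_nat.
  by rewrite AE itv_bndy_bigcup_BRight.
Qed.

(** * Decreasing rearrangements and comparison of Lorentz norms *)

Lemma rearr_ge0 (R : realType) (f : R -> R) t : (0 <= rearr f t)%E.
Proof. by apply: le_ereal_inf_tmp => _ [s [s0 _] <-]; rewrite lee_fin. Qed.

Lemma rearr_nonincreasing (R : realType) (f : R -> R) :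
  {homo rearr f : x y / x <= y >-> (y <= x)%E}.
Proof.
move=> x y xy; apply: ereal_inf_le_tmp => _ [s [s0 sx] <-].
by exists s => //; split => //; apply: (le_trans sx); rewrite lee_fin.
Qed.

(** As [rearr f] is nonincreasing, its layers are initial segments, where the two Stieltjes measures
    compare like the fundamental functions. *)
Lemma le_lorentz (R : realType) (phi1 phi2 : R -> R) (c : R) (f : R -> R) : 0 < c ->
  (forall t, 0 < t -> `|phi1 t| <= c * `|phi2 t|) ->
  (lorentz phi1 f <= c%:E * lorentz phi2 f)%E.
Proof.
move=> c0 le12.
have rearr_ni := @rearr_nonincreasing _ f.
apply: ge0_le_integral_layers => //; [|by move=> x _; exact: rearr_ge0|exact: ltW|].
  exact: nonincreasing_emeasurable.
move=> s s0; apply: le_measure_initial_segment.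
- move=> a a0; rewrite [X in (X <= _)%E](stieltjes_measure_itv_cc phi1 a0).
  rewrite [X in (_ <= _ * X)%E](stieltjes_measure_itv_cc phi2 a0) -EFinM lee_fin.
  exact: le_stieltjes_df.
- by move=> x [].
- move=> x y x0 xy [_ sy]; split; first by rewrite /= in_itv/= x0.
  by rewrite /= (lt_le_trans sy)// rearr_ni.
Qed.

(** The set where [|f|] exceeds [M] lies in [[0, t[], so [M] is admissible in the infimum defining
    the rearrangement. *)
Lemma rearr_le (R : realType) (f : R -> R) (M t : R) : 0 <= t -> 0 <= M ->
  (forall x, 0 < x -> t <= x -> `|f x| <= M) -> (rearr f t <= M%:E)%E.
Proof.
move=> t0 M0 fM; apply: ereal_inf_lbound; exists M => //; split => //.
pose A := [set x : R | 0 < x /\ M < `|f x|].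
have At : A `<=` `[0, t[.
  move=> x [x0 Mx]; rewrite /= in_itv/= (ltW x0) ltNge; apply/negP => tx.
  by have := fM _ x0 tx; rewrite leNgt Mx.
apply: (@le_trans _ _ (lebesgue_measure (`[0, t[%classic : set R))).
  (* The set [A] may be non-measurable, hence monotonicity of the outer measure. *)
  exact: le_outer_measure.
by rewrite lebesgue_measure_itv/= lte_fin; case: ltP; rewrite ?sube0 ?lee_fin.
Qed.

(** A level [s < M] is not admissible: [|f|] exceeds [s] on all of []0, x[], whose measure is larger
    than [t]. *)
Lemma rearr_ge (R : realType) (f : R -> R) (M t x : R) : t < x ->
  (forall y, 0 < y -> y < x -> M <= `|f y|) -> (M%:E <= rearr f t)%E.
Proof.
move=> tx Mf; apply: le_ereal_inf_tmp => _ [s [s0 sft] <-]; rewrite lee_fin leNgt.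
apply/negP => sM; move: sft; apply/negP; rewrite -ltNge.
have [t0|t0] := leP 0 t; last first.
  by apply: (@lt_le_trans _ _ 0%E); rewrite ?lte_fin// outer_measure_ge0.
apply: (@lt_le_trans _ _ (lebesgue_measure (`]0, x[%classic : set R))).
  by rewrite lebesgue_measure_itv/= lte_fin (le_lt_trans t0 tx) sube0 lte_fin.
apply: le_outer_measure => y /=; rewrite in_itv/= => /andP[y0 yx]; split => //.
by rewrite (lt_le_trans sM)// Mf.
Qed.

(** * Lorentz norms of indicators of initial intervals *)

Section quasi_concave_lorentz.
Variables (R : realType) (phi : R -> R).
Hypothesis phi_qc : quasi_concave phi.

Lemma quasi_concave_half t : 0 < t -> phi t / 2 <= phi (t / 2).
Proof.
move=> t0; have [p0 _ p_ni] := phi_qc.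
have t20 : 0 < t / 2 by rewrite divr_gt0.
have /p_ni/(_ _)/(ler_wpM2r (ltW t20)) : 0 < t / 2 by [].
move=> /(_ t); rewrite divfK ?gt_eqF// mulrA divfK ?gt_eqF//; apply.
by rewrite ler_pdivrMr// ler_peMr ?ltW// ltr1n.
Qed.

Let lsm := lebesgue_stieltjes_measure (stieltjes_df phi).

Lemma lorentz_indic_le a : 0 < a -> (lorentz phi \1_(`]0%R, a[) <= (phi a)%:E)%E.
Proof.
move=> a0; rewrite -(stieltjes_df_gt0 phi_qc a0) -(stieltjes_measure_itv_cc phi (ltW a0)).
apply: (@le_trans _ _ (\int[lsm]_(t in `[0%R, +oo[) (\1_(`[0%R, a[) t)%:E)%E).
  apply: ge0_le_integral => //.
  - by move=> x _; exact: rearr_ge0.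
  - by apply: nonincreasing_emeasurable => //; exact: rearr_nonincreasing.
  - exact/measurable_EFinP/measurable_indic.
  - move=> t /=; rewrite in_itv/= andbT => t0; apply: rearr_le => // x x0 tx.
    rewrite !indicE ger0_norm// ler_nat.
    case: (boolP (x \in `]0, a[%classic)) => // ; rewrite inE /= in_itv/= => /andP[_ xa].
    by rewrite mem_set//= in_itv/= t0 (le_lt_trans tx).
rewrite integral_indic//.
apply: le_measure; rewrite ?inE.
- by apply: measurableI; exact: measurable_itv.
- exact: measurable_itv.
- by move=> x [] /=; rewrite !in_itv/= => /andP[-> /ltW].
Qed.

(** The rearrangement is at least 1 on [[0, a / 2]], a segment of mass [phi (a / 2)]. Halving the
    interval costs a factor 2 but avoids the left limit of [phi] at [a]. *)
Lemma lorentz_indic_ge a : 0 < a -> ((phi a / 2)%:E <= lorentz phi \1_(`]0%R, a[))%E.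
Proof.
move=> a0; have a20 : 0 < a / 2 by rewrite divr_gt0.
apply: (@le_trans _ _ (phi (a / 2))%:E); first by rewrite lee_fin quasi_concave_half.
rewrite -(stieltjes_df_gt0 phi_qc a20) -(stieltjes_measure_itv_cc phi (ltW a20)).
apply: (@le_trans _ _ (\int[lsm]_(t in `[0%R, +oo[) (\1_(`[0%R, a / 2]) t)%:E)%E).
  rewrite integral_indic//.
  apply: le_measure; rewrite ?inE.
  - exact: measurable_itv.
  - by apply: measurableI; exact: measurable_itv.
  - by move=> x /=; rewrite !in_itv/= andbT => /andP[-> ->].
apply: ge0_le_integral => //.
- exact/measurable_EFinP/measurable_indic.
- by apply: nonincreasing_emeasurable => //; exact: rearr_nonincreasing.
- move=> t /=; rewrite in_itv/= andbT => t0; rewrite indicE.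
  case: (boolP (t \in _)) => [|_]; last exact: rearr_ge0.
  rewrite inE/= in_itv/= => /andP[_ ta]; apply: (@rearr_ge _ _ _ _ a).
    by rewrite (le_lt_trans ta)// ltr_pdivrMr// ltr_pMr// ltr1n.
  by move=> y y0 ya; rewrite indicE mem_set ?normr1//= in_itv/= y0.
Qed.

End quasi_concave_lorentz.

(** * The functions 1/(1 + s/t) and their Marcinkiewicz norms *)

Lemma rearr_inv1Ddiv (R : realType) (t s : R) : 0 < t -> 0 <= s ->
  rearr (fun x => (1 + x / t)^-1) s = ((1 + s / t)^-1)%:E.
Proof.
move=> t0 s0.
have gt1 x : 0 <= x -> 0 < 1 + x / t.
  by move=> x0; rewrite ltr_pwDl// divr_ge0// ltW.
have norm x : 0 <= x -> `|(1 + x / t)^-1| = (1 + x / t)^-1.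
  by move=> /gt1 x0; rewrite ger0_norm// invr_ge0 ltW.
have anti x y : 0 <= x -> x <= y -> (1 + y / t)^-1 <= (1 + x / t)^-1.
  move=> x0 xy; rewrite lef_pV2 ?posrE ?gt1// ?(le_trans x0)//.
  by rewrite lerD2l ler_pM2r// invr_gt0.
apply/eqP; rewrite eq_le; apply/andP; split.
  apply: rearr_le => // [|x x0 sx]; first by rewrite invr_ge0 ltW// gt1.
  by rewrite norm ?(ltW x0)// anti.
apply/lee_addgt0Pr => e e0.
have et : 0 < e * t by rewrite mulr_gt0.
have : (((1 + s / t)^-1 - e)%:E <= rearr (fun x : R => ((1 + x / t)^-1)%R) s)%E.
  (* Moving the point by [e * t] raises [s / t] by [e], and [u] to [(1 + u)^-1] is 1-Lipschitz for
     [u >= 0], so the value drops by at most [e]. *)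
  apply: (@rearr_ge _ _ _ _ (s + e * t)); first by rewrite ltrDl.
  move=> y y0 ye; rewrite norm ?(ltW y0)//.
  apply: (@le_trans _ _ (1 + (s + e * t) / t)^-1); last first.
    by apply: anti; exact: ltW.
  have u0 : 0 <= s / t by rewrite divr_ge0// ltW.
  rewrite mulrDl mulfK ?gt_eqF//; move: (s / t) u0 => u u0.
  rewrite lerBlDr -subr_ge0.
  have -> : (1 + (u + e))^-1 + e - (1 + u)^-1 = 
    e * ((1 + (u + e)) * (1 + u) - 1) / ((1 + (u + e)) * (1 + u)).
    by field; rewrite !gt_eqF//; lra.
  by apply: divr_ge0; nra.
by rewrite EFinB leeBlDr.
Qed.

Lemma rearr_avg_inv1Ddiv (R : realType) (t r : R) : 0 < t -> 0 < r ->
  rearr_avg (fun x => (1 + x / t)^-1) r = (t / r * ln (1 + r / t))%:E.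
Proof.
move=> t0 r0; rewrite /rearr_avg.
transitivity (r^-1%:E * \int[@lebesgue_measure R]_(s in `]0%R, r]) ((1 + s / t)^-1)%:E)%E.
  congr (_ * _)%E; apply: eq_integral => s.
  rewrite inE/= in_itv/= => /andP[/ltW s0 _]; exact: rearr_inv1Ddiv.
have gt0 (x : R) : 0 <= x -> 0 < 1 + x / t.
  by move=> x0; rewrite ltr_pwDl// divr_ge0// ltW.
(* An antiderivative of the integrand on [[0, +oo[]. *)
pose F s : R := t * ln (1 + s / t).
have dF (x : R) : 0 <= x -> is_derive x 1 F (1 + x / t)^-1.
  move=> x0; have := is_derive1_ln (gt0 x x0) => dln.
  have dg : is_derive x 1 (fun s : R => 1 + s / t) (t^-1).
    have := is_deriveD (is_derive_cst (1 : R) x 1) (is_deriveZ t^-1 (is_derive_id x 1)).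
    rewrite add0r /GRing.scale/= mulr1.
    by congr is_derive; apply/boolp.funext => s; rewrite mulrC.
  have := is_deriveZ t (@is_derive1_comp _ (@ln R) (fun s : R => 1 + s / t) _ _ _ dln dg).
  by rewrite (_ : t *: (_ * _) = (1 + x / t)^-1)// /GRing.scale/= mulrCA mulfV ?gt_eqF// mulr1.
have cF (x : R) : 0 <= x -> {for x, continuous F}.
  by move=> /dF /@ex_derive; move/derivable1_diffP/differentiable_continuous.
have cf (x : R) : 0 <= x -> {for x, continuous (fun s : R => (1 + s / t)^-1)}.
  move=> x0; apply: cvgV; first by rewrite gt_eqF// gt0.
  by apply: cvgD; [exact: cvg_cst|apply: cvgMl; exact: cvg_id].
rewrite integral_itv_obnd_cbnd; last first.
  apply: (eq_measurable_fun (rearr (fun x => (1 + x / t)^-1))).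
    move=> s; rewrite inE/= in_itv/= => /andP[/ltW s0 _]; exact: rearr_inv1Ddiv.
  by apply: nonincreasing_emeasurable => //; exact: rearr_nonincreasing.
rewrite (@continuous_FTC2 _ _ F)//.
- rewrite /F mul0r addr0 ln1 mulr0 sube0 -EFinM; congr EFin; ring.
- apply: continuous_in_subspaceT => x; rewrite inE/= in_itv/= => /andP[x0 _]; exact: cf.
- split.
  + by move=> x; rewrite in_itv/= => /andP[/ltW /dF /@ex_derive].
  + exact/cvg_at_right_filter/cF.
  + by apply/cvg_at_left_filter/cF/ltW.
- move=> x; rewrite in_itv/= => /andP[/ltW x0 _].
  by have dFx := dF x x0; rewrite derive1E derive_val.
Qed.

Lemma Wfun_marcinkiewicz (R : realType) (psi : R -> R) (t : R) : 0 < t ->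
  Wfun (marcinkiewicz psi) t =
  ereal_sup [set (t / r * ln (1 + r / t) * psi r)%:E | r in (`]0, +oo[ : set R)].
Proof.
move=> t0; rewrite /Wfun /marcinkiewicz; congr ereal_sup.
by apply/seteqP; split => _ [r /= r0 <-]; exists r => //;
  move: r0; rewrite in_itv/= andbT => r0; rewrite rearr_avg_inv1Ddiv ?EFinM.
Qed.

(** * Inequalities for ln(1 + x) *)

Lemma ln1D_gt0 (R : realType) (x : R) : 0 < x -> 0 < ln (1 + x).
Proof. by move=> x0; rewrite ln_gt0// ltrDl. Qed.

Lemma ler_ln1D (R : realType) (x y : R) : 0 < x -> x <= y -> ln (1 + x) <= ln (1 + y).
Proof. by move=> x0 xy; rewrite ler_ln ?posrE; lra. Qed.

(** Concavity of [ln]: [1 + x] is the convex combination of [1 + y] and [1] with weight [x / y], and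
    [ln 1 = 0]. In other words, ln(1 + x)/x decreases. *)
Lemma ln1D_sublinear (R : realType) (x y : R) : 0 < x -> x <= y ->
  x * ln (1 + y) <= y * ln (1 + x).
Proof.
move=> x0 xy; have y0 : 0 < y by exact: lt_le_trans xy.
have l0 : 0 <= x / y by rewrite divr_ge0// ltW.
have l1 : x / y <= 1 by rewrite ler_pdivrMr// mul1r.
have := @concave_ln R (Itv01 l0 l1) (1 + y) 1 (addr_gt0 ltr01 y0) ltr01.
rewrite !convRE /= ln1 mulr0 addr0 mulr1.
have -> : x / y * (1 + y) + (1 - x / y) = 1 + x by field; rewrite gt_eqF.
by rewrite mulrAC ler_pdivrMr// [_ * y]mulrC.
Qed.

Lemma ln1D_scale (R : realType) (u x : R) : 0 < u -> 0 < x ->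
  ln (1 + u * x) <= Num.max 1 u * ln (1 + x).
Proof.
move=> u0 x0; have lx := ln1D_gt0 x0.
have [u1|u1] := leP u 1.
  rewrite mul1r ler_ln1D ?mulr_gt0// -[leRHS]mul1r.
  by rewrite ler_pM2r.
have : x <= u * x by rewrite ler_peMl// ltW.
by move=> /(ln1D_sublinear x0); rewrite -[u * x * _]mulrA mulrCA ler_pM2l.
Qed.

(** * The function [qc_tilde phi] and its quasi-concavity *)

Section qc_tilde.
Variables (R : realType) (phi : R -> R).
Hypothesis phi_gt0 : forall t, 0 < t -> 0 < phi t.

(** The infimum of statement (iii): when positive, it is the largest [b] with
    [b * r * ln (1 + u / r) <= phi r] for all [r > 0], which links it to the coefficients in
    (iv). *)
Definition log_inf (u : R) := inf [set phi r / (r * ln (1 + u / r)) | r in `]0, +oo[].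

Lemma log_quotient_gt0 u r : 0 < u -> 0 < r -> 0 < phi r / (r * ln (1 + u / r)).
Proof.
by move=> u0 r0; rewrite divr_gt0 ?phi_gt0// mulr_gt0// ln1D_gt0// divr_gt0.
Qed.

Lemma log_inf_le u r : 0 < u -> 0 < r -> log_inf u <= phi r / (r * ln (1 + u / r)).
Proof.
move=> u0 r0; apply: ge_inf; last by exists r => //=; rewrite in_itv/= r0.
exists 0 => _ [s /= + <-]; rewrite in_itv/= andbT => s0.
by rewrite ltW// log_quotient_gt0.
Qed.

Lemma le_log_inf u M : (forall r, 0 < r -> M <= phi r / (r * ln (1 + u / r))) ->
  M <= log_inf u.
Proof.
move=> Mle; apply: lb_le_inf.
  by exists (phi 1 / (1 * ln (1 + u / 1))), 1 => //=; rewrite in_itv/= ltr01.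
by move=> _ [r /= + <-]; rewrite in_itv/= andbT => /Mle.
Qed.

Lemma qc_tildeE u : 0 < u -> qc_tilde phi u = u * log_inf u.
Proof.
move=> u0; apply/eqP; rewrite eq_le; apply/andP; split.
  rewrite -ler_pdivrMl//; apply: le_log_inf => r r0; rewrite ler_pdivrMl// mulrA.
  apply: ge_inf; last by exists r => //=; rewrite in_itv/= r0.
  exists 0 => _ [s /= + <-]; rewrite in_itv/= andbT => s0.
  by rewrite -mulrA ltW// mulr_gt0// log_quotient_gt0.
apply: lb_le_inf.
  by exists (u * phi 1 / (1 * ln (1 + u / 1))), 1 => //=; rewrite in_itv/= ltr01.
move=> _ [r /= + <-]; rewrite in_itv/= andbT => r0.
by rewrite -mulrA ler_pM2l// log_inf_le.
Qed.

(** The growth hypothesis enters here: since ln(1 + u/r) is at most [Num.max 1 u] times ln(1 + 1/r),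
    every quotient is at least [C / Num.max 1 u]. *)
Lemma log_inf_gt0 C u : 0 < C -> (forall t, 0 < t -> C * t * ln (1 + 1 / t) <= phi t) ->
  0 < u -> 0 < log_inf u.
Proof.
move=> C0 phi_log u0.
have m0 : 0 < Num.max 1 u by rewrite lt_max ltr01.
apply: (@lt_le_trans _ _ (C / Num.max 1 u)); first by rewrite divr_gt0.
apply: le_log_inf => r r0.
have ur : 0 < u / r by rewrite divr_gt0.
rewrite ler_pdivlMr ?mulr_gt0 ?ln1D_gt0//.
apply: le_trans (phi_log r r0).
rewrite mulrAC ler_pdivrMr// -!mulrA ler_pM2l// ler_pM2l//.
rewrite [X in _ <= X]mulrC div1r; apply: ln1D_scale => //.
by rewrite invr_gt0.
Qed.

(** For each fixed [r] the function u/ln(1 + u/r) increases in [u] and 1/ln(1 + u/r) decreases. Both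
    properties pass to the infimum over [r], which stays positive by [log_inf_gt0]. *)
Lemma quasi_concave_qc_tilde C : 0 < C ->
  (forall t, 0 < t -> C * t * ln (1 + 1 / t) <= phi t) ->
  quasi_concave (qc_tilde phi).
Proof.
move=> C0 phi_log; split.
- by move=> t t0; rewrite qc_tildeE// mulr_gt0// (log_inf_gt0 C0 phi_log).
- move=> s t s0 st; have t0 := lt_le_trans s0 st.
  rewrite !qc_tildeE// -[leRHS]mulrC -ler_pdivrMr//; apply: le_log_inf => r r0.
  have sr : 0 < s / r by rewrite divr_gt0.
  have tr : 0 < t / r by rewrite divr_gt0.
  have ls := ln1D_gt0 sr; have lt := ln1D_gt0 tr.
  rewrite ler_pdivrMr//.
  apply: (@le_trans _ _ (s * (phi r / (r * ln (1 + s / r))))).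
    by rewrite ler_pM2l// log_inf_le.
  have := @ln1D_sublinear R (s / r) (t / r) sr; rewrite ler_pM2r ?invr_gt0// => /(_ st).
  move: (ln (1 + s / r)) (ln (1 + t / r)) ls lt => a b a0 b0.
  rewrite mulrAC [X in _ <= X]mulrAC ler_pM2r ?invr_gt0// => sbta.
  (* With the common factor [phi r / (r * (a * b))] taken out, what remains is [s * b <= t * a]. *)
  have -> : s * (phi r / (r * a)) = (s * b) * (phi r / (r * (a * b))).
    by field; rewrite !gt_eqF.
  have -> : phi r / (r * b) * t = (t * a) * (phi r / (r * (a * b))).
    by field; rewrite !gt_eqF.
  by rewrite ler_wpM2r// ltW// divr_gt0 ?phi_gt0// !mulr_gt0.
- move=> s t s0 st; have t0 := lt_le_trans s0 st.
  rewrite !qc_tildeE// ![_ * log_inf _]mulrC !mulfK ?gt_eqF//.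
  apply: le_log_inf => r r0; apply: (le_trans (log_inf_le t0 r0)).
  have sr : 0 < s / r by rewrite divr_gt0.
  rewrite ler_pM2l ?phi_gt0// lef_pV2 ?posrE ?mulr_gt0 ?ln1D_gt0 ?divr_gt0//.
  by rewrite ler_pM2l// ler_ln1D// ler_pM2r// invr_gt0.
Qed.

End qc_tilde.

(** * The logarithmic kernel and the quasi-concavity of [W] *)

(** With v = r/t the kernel is ln(1 + v)/v, which decreases in [v] and so increases in [t]. *)
Lemma log_kernel_le (R : realType) (s t r : R) : 0 < s -> s <= t -> 0 < r ->
  s / r * ln (1 + r / s) <= t / r * ln (1 + r / t).
Proof.
move=> s0 st r0; have t0 := lt_le_trans s0 st.
have rt : 0 < r / t by rewrite divr_gt0.
have rts : r / t <= r / s by rewrite ler_pM2l// lef_pV2.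
have := ln1D_sublinear rt rts.
move: (ln (1 + r / s)) (ln (1 + r / t)) => a b abE.
have := ler_wpM2l (ltW (divr_gt0 (mulr_gt0 s0 t0) (mulr_gt0 r0 r0))) abE.
rewrite (_ : _ * (r / t * a) = s / r * a); last by field; rewrite !gt_eqF.
by rewrite (_ : _ * (r / s * b) = t / r * b)//; field; rewrite !gt_eqF.
Qed.

Lemma log_kernel_div_le (R : realType) (s t r : R) : 0 < s -> s <= t -> 0 < r ->
  t / r * ln (1 + r / t) <= t / s * (s / r * ln (1 + r / s)).
Proof.
move=> s0 st r0; have t0 := lt_le_trans s0 st.
rewrite !mulrA divfK ?gt_eqF// ler_pM2l ?divr_gt0//.
by rewrite ler_ln1D ?divr_gt0// ler_pM2l// lef_pV2.
Qed.

Section Wfun_marcinkiewicz.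
Variables (R : realType) (psi : R -> R).
Hypothesis psi_gt0 : forall t, 0 < t -> 0 < psi t.
Local Notation W := (Wfun (marcinkiewicz psi)).

Lemma Wfun_marcinkiewicz_ge t r : 0 < t -> 0 < r ->
  ((t / r * ln (1 + r / t) * psi r)%:E <= W t)%E.
Proof.
move=> t0 r0; rewrite Wfun_marcinkiewicz//; apply: ereal_sup_ubound.
by exists r => //=; rewrite in_itv/= r0.
Qed.

Lemma Wfun_marcinkiewicz_le t x : 0 < t ->
  (forall r, 0 < r -> ((t / r * ln (1 + r / t) * psi r)%:E <= x)%E) -> (W t <= x)%E.
Proof.
move=> t0 Wx; rewrite Wfun_marcinkiewicz//; apply: ge_ereal_sup => _ [r /= + <-].
by rewrite in_itv/= andbT => /Wx.
Qed.

Lemma Wfun_marcinkiewicz_gt0 t : 0 < t -> (0 < W t)%E.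
Proof.
move=> t0; apply: lt_le_trans (Wfun_marcinkiewicz_ge t0 t0).
by rewrite lte_fin !mulr_gt0 ?invr_gt0 ?psi_gt0// ln1D_gt0// divr_gt0.
Qed.

Lemma Wfun_marcinkiewicz_nondecreasing s t : 0 < s -> s <= t -> (W s <= W t)%E.
Proof.
move=> s0 st; apply: Wfun_marcinkiewicz_le => // r r0.
apply: le_trans (Wfun_marcinkiewicz_ge (lt_le_trans s0 st) r0).
by rewrite lee_fin ler_pM2r ?psi_gt0// log_kernel_le.
Qed.

(** The decrease of [W t / t], in product form because [W] may still be infinite here. *)
Lemma Wfun_marcinkiewicz_div s t : 0 < s -> s <= t -> (W t <= (t / s)%:E * W s)%E.
Proof.
move=> s0 st; have t0 := lt_le_trans s0 st.
apply: Wfun_marcinkiewicz_le => // r r0.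
apply: (@le_trans _ _ ((t / s)%:E * (s / r * ln (1 + r / s) * psi r)%:E)%E).
  by rewrite -EFinM lee_fin mulrA ler_pM2r ?psi_gt0// log_kernel_div_le.
by rewrite lee_pmul2l// ?lte_fin ?divr_gt0// Wfun_marcinkiewicz_ge.
Qed.

Hypothesis W1_fin : (W 1 < +oo)%E.

(** Finiteness spreads from the point 1: to the left by monotonicity, to the right by
    [W t <= t * W 1]. *)
Lemma Wfun_marcinkiewicz_fin_num t : 0 < t -> W t \is a fin_num.
Proof.
move=> t0; rewrite (ge0_fin_numE (ltW (Wfun_marcinkiewicz_gt0 t0))).
have [t1|/ltW t1] := leP t 1.
  by apply: le_lt_trans W1_fin; exact: Wfun_marcinkiewicz_nondecreasing.
apply: (le_lt_trans (Wfun_marcinkiewicz_div ltr01 t1)).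
by apply: lte_mul_pinfty; rewrite ?lee_fin ?divr_ge0// ltW.
Qed.

Lemma quasi_concave_Wfun_marcinkiewicz : quasi_concave (fun t => fine (W t)).
Proof.
split.
- move=> t t0; apply: fine_gt0; apply/andP; split; first exact: Wfun_marcinkiewicz_gt0.
  by have /fin_numPlt/andP[] := Wfun_marcinkiewicz_fin_num t0.
- move=> s t s0 st; have t0 := lt_le_trans s0 st.
  apply: fine_le (Wfun_marcinkiewicz_nondecreasing s0 st);
    exact: Wfun_marcinkiewicz_fin_num.
- move=> s t s0 st; have t0 := lt_le_trans s0 st.
  move: (Wfun_marcinkiewicz_fin_num s0) (Wfun_marcinkiewicz_fin_num t0).
  move: (Wfun_marcinkiewicz_div s0 st).
  move: (W s) (W t) => [a| |] [b| |] //; rewrite -EFinM lee_fin => ba _ _ /=.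
  by rewrite ler_pdivrMr// [leRHS]mulrAC -mulrA mulrC.
Qed.

End Wfun_marcinkiewicz.

(** * Equality of spaces as equivalence of fundamental functions *)

Lemma in_space_marcinkiewicz_inv1D (R : realType) (psi : R -> R) :
  in_space (marcinkiewicz psi) (fun s => (1 + s)^-1) <->
  (Wfun (marcinkiewicz psi) 1 < +oo)%E.
Proof.
have gE : (fun s : R => (1 + s / 1)^-1) = (fun s => (1 + s)^-1).
  by apply/boolp.funext => s; rewrite divr1.
rewrite /in_space /Wfun gE; split => [[]//|Wfin]; split => //.
apply/measurable_EFinP; apply: (eq_measurable_fun (rearr (fun x : R => (1 + x / 1)^-1))).
  by move=> s; rewrite inE/= in_itv/= andbT => /ltW s0; rewrite rearr_inv1Ddiv//= divr1.
by apply: nonincreasing_emeasurable => //; exact: rearr_nonincreasing.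
Qed.

Lemma same_space_lorentz (R : realType) (phi psi : R -> R) (c : R) : 0 < c ->
  (forall t, 0 < t -> `|phi t| <= c * `|psi t|) ->
  (forall t, 0 < t -> `|psi t| <= c * `|phi t|) ->
  same_space (lorentz phi) (lorentz psi).
Proof.
move=> c0 le1 le2.
have fin (g h : R -> R) f : (lorentz g f <= c%:E * lorentz h f)%E ->
    (lorentz h f < +oo)%E -> (lorentz g f < +oo)%E.
  move=> /le_lt_trans gh hf; apply: gh; apply: lte_mul_pinfty => //; first by rewrite lee_fin ltW.
split.
  move=> f; split => -[mf ff]; split=> [|].
  - exact: mf.
  - exact: (fin _ _ _ (le_lorentz f c0 le2) ff).
  - exact: mf.
  - exact: (fin _ _ _ (le_lorentz f c0 le1) ff).
exists c => [|f _]; first exact: c0.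
split; last exact: (le_lorentz f c0 le1).
rewrite lee_pdivrMl//; exact: (le_lorentz f c0 le2).
Qed.

(** Test the norm inequality on the indicator of []0, t[]; the factor 2 comes from
    [lorentz_indic_ge]. *)
Lemma lorentz_le_quasi_concave (R : realType) (phi psi : R -> R) (c : R) :
  quasi_concave phi -> quasi_concave psi -> 0 < c ->
  (forall f, in_space (lorentz phi) f -> (lorentz phi f <= c%:E * lorentz psi f)%E) ->
  forall t, 0 < t -> phi t <= 2 * c * psi t.
Proof.
move=> phi_qc psi_qc c0 lec t t0.
have inf : in_space (lorentz phi) \1_(`]0%R, t[).
  split; first exact: measurable_indic.
  by apply: (le_lt_trans (lorentz_indic_le phi_qc t0)); rewrite ltry.
have := le_trans (lorentz_indic_ge phi_qc t0) (lec _ inf).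
move=> /le_trans => /(_ (c%:E * (psi t)%:E)%E).
rewrite lee_pmul2l ?lte_fin// => /(_ (lorentz_indic_le psi_qc t0)).
by rewrite -EFinM lee_fin ler_pdivrMr// mulrC mulrA.
Qed.

(** Excludes the degenerate case of [Rspace], because a Lorentz space of a quasi-concave function
    contains this indicator. *)
Lemma zero_space_indic (R : realType) :
  ~ in_space (@zero_space R) \1_(`]0%R, 1[).
Proof.
case=> _; rewrite /zero_space; case: asboolP => [[A [mA A0 sA]] _|//].
have : (lebesgue_measure (`]0%R, 1%R[%classic : set R) <= 0)%E.
  rewrite -A0; apply: le_measure; rewrite ?inE//.
  move=> x x01; apply: sA => /= /(_ _)/eqP.
  rewrite indicE mem_set//= oner_eq0; move: x01; rewrite /= in_itv/= => /andP[x0 _].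
  by move/(_ x0).
by rewrite lebesgue_measure_itv/= lte_fin ltr01 sube0 lee_fin ler10.
Qed.

(** The right side is stated in the extended reals, so the upper bound on [W] also carries its
    finiteness, which selects the Lorentz branch of [Rspace]. Conversely, [zero_space_indic] rules
    out the zero branch. *)
Lemma same_space_Rspace_marcinkiewicz (R : realType) (phi psi : R -> R) :
  quasi_concave phi -> quasi_concave psi ->
  same_space (lorentz phi) (Rspace (marcinkiewicz psi)) <->
  exists2 c : R, 0 < c & forall t, 0 < t ->
    ((phi t)%:E <= c%:E * Wfun (marcinkiewicz psi) t)%E /\
    (Wfun (marcinkiewicz psi) t <= (c * phi t)%:E)%E.
Proof.
move=> phi_qc psi_qc; have [psi0 _ _] := psi_qc; have [phi0 _ _] := phi_qc.
split.
  move=> [sp [c c0 le_c]].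
  have [inX|ninX] := pselect (in_space (marcinkiewicz psi) (fun s => (1 + s)^-1)); last first.
    exfalso; apply: (@zero_space_indic R).
    move: sp; rewrite /Rspace asboolF// => sp; apply/sp; split.
      exact: measurable_indic.
    by apply: (le_lt_trans (lorentz_indic_le phi_qc ltr01)); rewrite ltry.
  have W1 := (in_space_marcinkiewicz_inv1D psi).1 inX.
  pose w t := fine (Wfun (marcinkiewicz psi) t).
  have w_qc : quasi_concave w by exact: quasi_concave_Wfun_marcinkiewicz.
  have RE : Rspace (marcinkiewicz psi) = lorentz w by rewrite /Rspace asboolT.
  rewrite RE in sp le_c.
  have le1 := lorentz_le_quasi_concave phi_qc w_qc c0 (fun f fX => (le_c f fX).2).
  have le2 : forall t, 0 < t -> w t <= 2 * c * phi t.
    apply: (lorentz_le_quasi_concave w_qc phi_qc c0) => f fw.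
    by have [+ _] := le_c f ((sp f).2 fw); rewrite lee_pdivrMl.
  exists (2 * c) => [|t t0]; first by rewrite mulr_gt0.
  rewrite -(fineK (Wfun_marcinkiewicz_fin_num psi0 W1 t0)) -EFinM !lee_fin.
  by split; [exact: le1|exact: le2].
move=> [c c0 le_c].
have W1 : (Wfun (marcinkiewicz psi) 1 < +oo)%E.
  by apply: (le_lt_trans (le_c 1 ltr01).2); rewrite ltry.
have inX := (in_space_marcinkiewicz_inv1D psi).2 W1.
pose w t := fine (Wfun (marcinkiewicz psi) t).
have RE : Rspace (marcinkiewicz psi) = lorentz w by rewrite /Rspace asboolT.
have [w0 _ _] : quasi_concave w by exact: quasi_concave_Wfun_marcinkiewicz.
have wE t : 0 < t -> phi t <= c * w t /\ w t <= c * phi t.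
  move=> t0; have := le_c t t0.
  by rewrite -(fineK (Wfun_marcinkiewicz_fin_num psi0 W1 t0)) -EFinM !lee_fin.
rewrite RE; apply: (same_space_lorentz c0) => t t0;
  rewrite !gtr0_norm ?w0 ?phi0//; by have [] := wE t t0.
Qed.

(** * The implications between the four statements *)

Section Rspace_qc_tilde.
Variables (R : realType) (phi : R -> R) (C : R).
Hypothesis phi_qc : quasi_concave phi.
Hypothesis C_gt0 : 0 < C.
Hypothesis phi_log : forall t, 0 < t -> C * t * ln (1 + 1 / t) <= phi t.

Local Notation W psi := (Wfun (marcinkiewicz psi)).

Let phi_gt0 t : 0 < t -> 0 < phi t.
Proof. by case: phi_qc => + _ _; exact. Qed.

(** Bounding the infimum in [qc_tilde phi r] by its quotient at [t] cancels the kernel exactly. *)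
Lemma Wfun_marcinkiewicz_qc_tilde_le t : 0 < t -> (W (qc_tilde phi) t <= (phi t)%:E)%E.
Proof.
move=> t0; apply: Wfun_marcinkiewicz_le => // r r0; rewrite lee_fin qc_tildeE//.
have l0 : 0 < ln (1 + r / t) by rewrite ln1D_gt0// divr_gt0.
have := log_inf_le phi_gt0 r0 t0; rewrite ler_pdivlMr ?mulr_gt0//.
apply: le_trans; rewrite le_eqVlt; apply/orP; left; apply/eqP.
by field; rewrite !gt_eqF.
Qed.

(** Maximality of [qc_tilde phi]: solve each kernel term of [W psi t] for [psi r], then take the
    infimum over [t]. *)
Lemma le_qc_tilde psi c r : 0 < c ->
  (forall t, 0 < t -> (W psi t <= (c * phi t)%:E)%E) ->
  0 < r -> psi r <= c * qc_tilde phi r.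
Proof.
move=> c0 Wle r0; rewrite qc_tildeE// mulrA -ler_pdivrMl ?mulr_gt0//.
apply: le_log_inf => t t0.
have l0 : 0 < ln (1 + r / t) by rewrite ln1D_gt0// divr_gt0.
have := le_trans (Wfun_marcinkiewicz_ge psi t0 r0) (Wle t t0).
rewrite lee_fin -ler_pdivrMl// ler_pdivlMr ?mulr_gt0//.
apply: le_trans; rewrite le_eqVlt; apply/orP; left; apply/eqP.
by field; rewrite !gt_eqF.
Qed.

(** The upper bound on [W] holds with constant 1, so only the lower one is a condition;
    [Num.max 1 c] serves both. *)
Lemma Rspace_qc_tildeP :
  same_space (lorentz phi) (Rspace (marcinkiewicz (qc_tilde phi))) <->
  exists2 c : R, 0 < c & forall t, 0 < t ->
    ((phi t)%:E <= c%:E * W (qc_tilde phi) t)%E.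
Proof.
have qt_qc := quasi_concave_qc_tilde phi_gt0 C_gt0 phi_log.
split=> [/(same_space_Rspace_marcinkiewicz phi_qc qt_qc)[c c0 cP]|[c c0 cP]].
  by exists c => // t /cP[].
apply/(same_space_Rspace_marcinkiewicz phi_qc qt_qc).
exists (Num.max 1 c) => [|t t0]; first by rewrite lt_max ltr01.
have Wge0 : (0 <= W (qc_tilde phi) t)%E.
  by apply: ltW; apply: Wfun_marcinkiewicz_gt0 => //; case: qt_qc.
split.
  apply: (le_trans (cP t t0)); apply: lee_wpmul2r => //.
  by rewrite lee_fin le_max lexx orbT.
apply: (le_trans (Wfun_marcinkiewicz_qc_tilde_le t0)).
by rewrite lee_fin ler_peMl ?(ltW (phi_gt0 t0))// le_max lexx.
Qed.

(** By maximality [W psi] is at most [c] times [W (qc_tilde phi)]; combined with [phi <= c * W psi]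
    this gives the constant [c * c]. *)
Lemma Rspace_qc_tilde_of_Rspace psi : quasi_concave psi ->
  same_space (lorentz phi) (Rspace (marcinkiewicz psi)) ->
  same_space (lorentz phi) (Rspace (marcinkiewicz (qc_tilde phi))).
Proof.
move=> psi_qc /(same_space_Rspace_marcinkiewicz phi_qc psi_qc)[c c0 cP].
apply/Rspace_qc_tildeP; exists (c * c) => [|t t0]; first by rewrite mulr_gt0.
apply: (le_trans (cP t t0).1).
rewrite EFinM -muleA lee_pmul2l ?lte_fin//.
apply: Wfun_marcinkiewicz_le => // r r0.
apply: (@le_trans _ _ (c%:E * (t / r * ln (1 + r / t) * qc_tilde phi r)%:E)%E).
  rewrite -EFinM lee_fin mulrCA ler_pM2l; last first.
    by rewrite mulr_gt0 ?ln1D_gt0// divr_gt0.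
  by apply: le_qc_tilde => // s s0; exact: (cP s s0).2.
by rewrite lee_pmul2l ?lte_fin// Wfun_marcinkiewicz_ge.
Qed.

(** If every [u] failed at [t], each term of the supremum [W (qc_tilde phi) t] would be at most
    [phi t / (2 * c)], against [phi t <= c * W (qc_tilde phi) t]. The factor 2 makes the
    contradiction strict, as the supremum need not be attained. *)
Lemma log_inf_attained_up_to_constant :
  same_space (lorentz phi) (Rspace (marcinkiewicz (qc_tilde phi))) ->
  exists2 K : R, 0 < K & forall t, 0 < t -> exists2 u : R, 0 < u &
    phi t / (t * ln (1 + u / t)) <= K * log_inf phi u.
Proof.
move=> /Rspace_qc_tildeP[c c0 cP]; exists (2 * c) => [|t t0]; first by rewrite mulr_gt0.
apply: contrapT => noK.
have : (W (qc_tilde phi) t <= (phi t / (2 * c))%:E)%E.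
  apply: Wfun_marcinkiewicz_le => // u u0; rewrite lee_fin qc_tildeE//.
  have l0 : 0 < ln (1 + u / t) by rewrite ln1D_gt0// divr_gt0.
  rewrite ler_pdivlMr ?mulr_gt0// leNgt; apply/negP => lt_phi; apply: noK.
  exists u => //; rewrite ler_pdivrMr ?mulr_gt0//; apply: (le_trans (ltW lt_phi)).
  rewrite le_eqVlt; apply/orP; left; apply/eqP.
  by field; rewrite !gt_eqF.
have := cP t t0; rewrite -lee_pdivrMl// => /le_trans le /le.
rewrite -EFinM lee_fin leNgt => /negP; apply.
rewrite invfM mulrA mulrC ltr_pM2l ?invr_gt0// ltr_pdivrMr//.
by rewrite ltr_pMr ?phi_gt0// ltr1n.
Qed.

(** Take for [a k] a near-optimal [u] at the [k]-th positive rational and [b k = log_inf phi (a k)].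
    The envelope is below [phi] by definition of the infimum; the other bound is transferred from a
    nearby rational. *)
Lemma log_envelope_of_log_inf (K : R) : 0 < K ->
  (forall t, 0 < t -> exists2 u : R, 0 < u &
    phi t / (t * ln (1 + u / t)) <= K * log_inf phi u) ->
  exists a b : nat -> R, (forall k, 0 < a k /\ 0 < b k) /\
    approx_eq (fun t => (phi t)%:E) (fun t => (t%:E *
      ereal_sup [set (b k * ln (1 + a k / t))%:E | k in [set: nat]])%E).
Proof.
move=> K0 /(_ _ _)/cid2 PK.
(* Enumerates the positive rationals; codes of no rational or of a nonpositive one get the default
   1, which keeps [q] positive. *)
pose q (k : nat) : R := if (unpickle k : option rat) is Some x then
  (if 0 < x then ratr x else 1) else 1.
have q0 k : 0 < q k.
  rewrite /q; case: (unpickle k) => [x|//]; case: ifPn => // x0.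
  by rewrite ltr0q.
pose a k := sval (PK _ (q0 k)).
have a0 k : 0 < a k by rewrite /a; case: (PK _ _).
have aP k : phi (q k) / (q k * ln (1 + a k / q k)) <= K * log_inf phi (a k).
  by rewrite /a; case: (PK _ _).
exists a, (fun k => log_inf phi (a k)); split.
  by move=> k; split => //; exact: (log_inf_gt0 C_gt0 phi_log).
have m0 : 0 < Num.max 1 (2 * K) by rewrite lt_max ltr01.
exists (Num.max 1 (2 * K)) => // t t0.
have l0 k : 0 < ln (1 + a k / t) by rewrite ln1D_gt0// divr_gt0.
set S := ereal_sup _.
have Sle : (t%:E * S <= (phi t)%:E)%E.
  rewrite -lee_pdivlMl// -EFinM; apply: ge_ereal_sup => _ [k _ <-].
  rewrite lee_fin ler_pdivlMl//.
  have := log_inf_le phi_gt0 (a0 k) t0; rewrite ler_pdivlMr ?mulr_gt0//.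
  by rewrite mulrCA.
split.
  rewrite lee_pdivrMl// ; apply: (le_trans Sle).
  by rewrite lee_fin ler_peMl ?(ltW (phi_gt0 t0))// le_max lexx.
(* Going from [t] up to a rational [q k] below [2 * t] increases [phi], while
   [q k * ln (1 + a k / q k)] is at most [2 * t * ln (1 + a k / t)]; hence the constant [2 * K]. *)
have [x tx2] : exists x : rat, ratr x \in `]t, 2 * t[.
  by apply: rat_in_itvoo; rewrite ltr_pMl// ltr1n.
move: tx2; rewrite in_itv/= => /andP[tx x2t].
have x0 : 0 < x by rewrite -(ltr0q R) (lt_trans t0).
pose k := pickle x.
have qE : q k = ratr x by rewrite /q /k pickleK x0.
have tq : t <= q k by rewrite qE ltW.
have Sk : ((log_inf phi (a k) * ln (1 + a k / t))%:E <= S)%E.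
  by apply: ereal_sup_ubound; exists k.
apply: (@le_trans _ _ ((2 * K)%:E * (t%:E * (log_inf phi (a k) * ln (1 + a k / t))%:E))%E).
  rewrite -!EFinM lee_fin.
  have [_ phi_nd _] := phi_qc.
  apply: (le_trans (phi_nd _ _ t0 tq)).
  have lq0 : 0 < ln (1 + a k / q k) by rewrite ln1D_gt0// divr_gt0.
  have := aP k; rewrite ler_pdivrMr ?mulr_gt0// => /le_trans; apply.
  have li0 : 0 < log_inf phi (a k) by exact: (log_inf_gt0 C_gt0 phi_log).
  have -> : 2 * K * (t * (log_inf phi (a k) * ln (1 + a k / t))) =
    K * log_inf phi (a k) * (2 * t * ln (1 + a k / t)) by ring.
  rewrite ler_pM2l ?mulr_gt0//; apply: ler_pM; rewrite ?(ltW (q0 k)) ?(ltW lq0)//.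
    by rewrite qE ltW.
  apply: ler_ln1D; first exact: divr_gt0.
  by rewrite ler_pM2l ?a0// lef_pV2 ?posrE ?q0.
have tS0 : (0 <= t%:E * S)%E.
  apply: mule_ge0; first by rewrite lee_fin ltW.
  apply: le_trans Sk; rewrite lee_fin mulr_ge0// ?ltW//.
  exact: (log_inf_gt0 C_gt0 phi_log).
apply: (@le_trans _ _ ((2 * K)%:E * (t%:E * S))%E).
  by rewrite lee_pmul2l ?lte_fin ?mulr_gt0// lee_pmul2l.
by apply: lee_wpmul2r => //; rewrite lee_fin le_max lexx orbT.
Qed.

(** Each term of the envelope is below [c * phi] everywhere, so [b k <= c * log_inf phi (a k)]. Its
    value at [t] is then at most [c] times the term [r = a k] of [W (qc_tilde phi) t]. *)
Lemma Rspace_qc_tilde_of_log_envelope (a b : nat -> R) :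
  (forall k, 0 < a k /\ 0 < b k) ->
  approx_eq (fun t => (phi t)%:E) (fun t => (t%:E *
    ereal_sup [set (b k * ln (1 + a k / t))%:E | k in [set: nat]])%E) ->
  same_space (lorentz phi) (Rspace (marcinkiewicz (qc_tilde phi))).
Proof.
move=> ab0 [c c0 cP]; apply/Rspace_qc_tildeP; exists (c * c) => [|t t0]; first by rewrite mulr_gt0.
apply: (le_trans (cP t t0).2); rewrite EFinM -muleA lee_pmul2l ?lte_fin//.
rewrite -lee_pdivlMl//; apply: ge_ereal_sup => _ [k _ <-]; rewrite lee_pdivlMl//.
have [a0 b0] := ab0 k.
have l0 : 0 < ln (1 + a k / t) by rewrite ln1D_gt0// divr_gt0.
have b_le : b k <= c * log_inf phi (a k).
  rewrite -ler_pdivrMl//; apply: le_log_inf => r r0.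
  have lr0 : 0 < ln (1 + a k / r) by rewrite ln1D_gt0// divr_gt0.
  have [+ _] := cP r r0; rewrite lee_pdivrMl//.
  have Sk : ((b k * ln (1 + a k / r))%:E <=
      ereal_sup [set (b k * ln (1 + a k / r))%:E | k in [set: nat]])%E.
    by apply: ereal_sup_ubound; exists k.
  have rSk : (r%:E * (b k * ln (1 + a k / r))%:E <=
      r%:E * ereal_sup [set (b k * ln (1 + a k / r))%:E | k in [set: nat]])%E.
    by rewrite lee_pmul2l.
  move=> /(le_trans rSk); rewrite -!EFinM lee_fin => brc.
  by rewrite ler_pdivlMr ?mulr_gt0// -mulrA ler_pdivrMl// mulrCA.
apply: (@le_trans _ _ (c%:E * (t / a k * ln (1 + a k / t) * qc_tilde phi (a k))%:E)%E).
  rewrite -!EFinM lee_fin qc_tildeE//.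
  have -> : c * (t / a k * ln (1 + a k / t) * (a k * log_inf phi (a k))) =
    t * (c * log_inf phi (a k) * ln (1 + a k / t)) by field; rewrite gt_eqF.
  by rewrite ler_pM2l// ler_pM2r.
by rewrite lee_pmul2l ?lte_fin// Wfun_marcinkiewicz_ge.
Qed.

End Rspace_qc_tilde.

Unset Implicit Arguments.

Theorem theorem4p5 (R : realType) (phi : R -> R)
    (phi_qc : quasi_concave phi)
    (phi_log : exists2 C : R, 0 < C &
       forall t, 0 < t -> C * t * ln (1 + 1 / t) <= phi t) :
  [<-> (* (i) *)
       exists2 psi : R -> R, quasi_concave psi &
         same_space (lorentz phi) (Rspace (marcinkiewicz psi));
       (* (ii) *)
       same_space (lorentz phi) (Rspace (marcinkiewicz (qc_tilde phi)));
       (* (iii) *)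
       exists2 K : R, 0 < K & forall t, 0 < t -> exists2 u : R, 0 < u &
         let m := inf [set phi r / (r * ln (1 + u / r)) | r in `]0, +oo[] in
         m <= phi t / (t * ln (1 + u / t)) <= K * m;
       (* (iv) *)
       exists a b : nat -> R,
         (forall k, 0 < a k /\ 0 < b k) /\
         approx_eq (fun t => (phi t)%:E)
           (fun t => (t%:E *
              ereal_sup [set (b k * ln (1 + a k / t))%:E | k in [set: nat]])%E)].
Proof.
have [C C0 phiC] := phi_log; have [phi0 _ _] := phi_qc.
tfae.
- move=> [psi psi_qc]; exact: (Rspace_qc_tilde_of_Rspace phi_qc C0 phiC psi_qc).
- move=> /(log_inf_attained_up_to_constant phi_qc C0 phiC)[K K0 KP].
  exists K => // t t0; have [u u0 uP] := KP t t0; exists u => //.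
  by apply/andP; split => //; exact: log_inf_le.
- move=> [K K0 KP]; apply: (log_envelope_of_log_inf phi_qc C0 phiC K0) => t t0.
  by have [u u0 /andP[_ uP]] := KP t t0; exists u.
(* The cycle closes through (ii): [qc_tilde phi] itself is the witness for (i). *)
- move=> [a [b [ab0 approx]]]; exists (qc_tilde phi).
    exact: (quasi_concave_qc_tilde phi0 C0 phiC).
  exact: (Rspace_qc_tilde_of_log_envelope phi_qc C0 phiC ab0 approx).
Qed.
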